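(* Let $r\ge 2$, let $m_1,\dots,m_r$ be positive integers and $k=\sum_{i=1}^r m_i$. Then $$\binom{k}{m_1,m_2,\dots,m_r}=\sum_{(B_1,B_2)\in\mathcal B'}\binom{k-r+2}{S(B_2)-|B_2|+1}\cdot\binom{S(B_1)}{B_1}\cdot\binom{S(B_2)}{B_2},$$ where $\mathcal B'$ is the set of all pairs $(B_1,B_2)$ such that $X=\{x_1,\dots,x_r\}$ is the disjoint union of $B_1$ and $B_2$, $x_1\in B_1$ and $x_2\in B_2$.
   Context: $X=\{x_1,\dots,x_r\}$ is a set of $r$ distinct indeterminates. The function $g$ on $X$ is given by $g(x_1)=m_1-1$ and $g(x_i)=m_i$ for $i>1$. For $B\subset X$ put $S(B)=\sum_{x\in B}g(x)$ and $\binom{S(B)}{B}=\dfrac{S(B)!}{\prod_{x\in B}g(x)!}$. $|B|$ is the cardinality of $B$. $\binom{k}{m_1,\dots,m_r}=k!/(m_1!\cdots m_r!)$. *)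

(* Defs.v *)
From mathcomp Require Import all_boot.

Set Implicit Arguments.
Unset Strict Implicit.
Unset Printing Implicit Defensive.

(* The indeterminates x_1, ..., x_r are represented by their indices in 'I_r,
   shifted by one: x_i is the ordinal of value i - 1. *)
Definition x1 (r : nat) (hr : 2 <= r) : 'I_r := Ordinal (ltnW hr).
Definition x2 (r : nat) (hr : 2 <= r) : 'I_r := Ordinal hr.

(* The truncated subtraction is harmless: g is used with all m i positive. *)
Definition g (r : nat) (hr : 2 <= r) (m : 'I_r -> nat) (i : 'I_r) : nat :=
  if i == x1 hr then m i - 1 else m i.

Definition sumg (r : nat) (hr : 2 <= r) (m : 'I_r -> nat)
    (B : {set 'I_r}) : nat :=
  \sum_(x in B) g hr m x.

(* The quotients in multinomial (for k = \sum_i m i) and in setbinom are exact: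
   see dvdn_prod_fact below. *)
Definition multinomial (r k : nat) (m : 'I_r -> nat) : nat :=
  k`! %/ \prod_(i < r) (m i)`!.

Definition setbinom (r : nat) (hr : 2 <= r) (m : 'I_r -> nat)
    (B : {set 'I_r}) : nat :=
  (sumg hr m B)`! %/ \prod_(x in B) (g hr m x)`!.

Definition calB' (r : nat) (hr : 2 <= r) : {set {set 'I_r} * {set 'I_r}} :=
  [set B : {set 'I_r} * {set 'I_r} |
    [&& B.1 :|: B.2 == [set: 'I_r], [disjoint B.1 & B.2],
        x1 hr \in B.1 & x2 hr \in B.2]].

Lemma dvdn_prod_fact (I : finType) (P : pred I) (f : I -> nat) :
  \prod_(i | P i) (f i)`! %| (\sum_(i | P i) f i)`!.
Proof.
apply: (big_ind2 (fun p s => p %| s`!)) => // p1 s1 p2 s2 h1 h2.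
have hle : s1 <= s1 + s2 by apply: leq_addr.
by rewrite -(bin_fact hle) addKn dvdn_mull // dvdn_mul.
Qed.

(* Main.v *)
(** Let Y = X \ {x_1, x_2} and t_i = m_i - 1.  After clearing factorials and
    writing B_1 = {x_1} + A, B_2 = {x_2} + (Y \ A), the identity becomes the
    Hurwitz-type convolution  sum_A F_A(x) G_{Y \ A}(y) = G_Y(x + y)  at
    x = m_1, y = m_2, where, with T = sum_{i in A} t_i and n = |A|,
      F_A(x) = x (x+T+1) ... (x+T+n-1),   G_A(y) = (y+T+1) ... (y+T+n).
    Both families satisfy the same difference equation
      P_A(x+1) - P_A(x) = sum_{i in A} P_{A \ i}(x + m_i),
    and F_A(0) = 0 unless A is empty, so the convolution follows by induction
    on |Y| and then on x. *)

Require Import Defs.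
From mathcomp Require Import all_boot.
From mathcomp Require Import zify.

(** Discrete derivative of a falling power, the source of both difference equations below. *)
Lemma ffactS_diff (z p : nat) : z.+1 ^_ p.+1 = z ^_ p.+1 + p.+1 * z ^_ p.
Proof.
rewrite ffactSS ffactnSr mulnC; case: (leqP p z) => hpz.
  by rewrite mulnC [_ ^_ _ * _]mulnC -mulnDl; congr (_ * _); lia.
by rewrite ffact_small // !muln0.
Qed.

Section Hurwitz.
Set Implicit Arguments.
Variables (I : finType) (t : I -> nat).
Implicit Types (A Y : {set I}).

Definition tsum A : nat := \sum_(i in A) t i.

Definition hurwitzG A (y : nat) : nat := (y + tsum A + #|A|) ^_ #|A|.

(** The empty set is split off because the general formula would give [x] there, not 1. *)
Definition hurwitzF A (x : nat) : nat :=
  if A == set0 then 1 else x * (x + tsum A + #|A|.-1) ^_ #|A|.-1.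

Lemma tsumD1 A i : i \in A -> tsum A = t i + tsum (A :\ i).
Proof. by move=> iA; rewrite /tsum (big_setD1 i). Qed.

(** Removing [i] while adding [(t i).+1] to [y] keeps [y + tsum A + #|A|] fixed, so all summands
    coincide. *)
Lemma hurwitzG_step A y :
  hurwitzG A y.+1 = hurwitzG A y + \sum_(i in A) hurwitzG (A :\ i) (y + (t i).+1).
Proof.
case hA: #|A| => [|p].
  by rewrite /hurwitzG hA !ffactn0 (cards0_eq hA) big_set0.
rewrite (eq_bigr (fun=> (y + tsum A + p.+1) ^_ p)) => [|i iA].
  by rewrite sum_nat_const /hurwitzG hA !addSn ffactS_diff.
have hi : #|A :\ i| = p by move: (cardsD1 i A); rewrite iA hA; lia.
by rewrite /hurwitzG hi (tsumD1 iA); congr (_ ^_ _); lia.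
Qed.

Lemma hurwitzF_step A x :
  hurwitzF A x.+1 = hurwitzF A x + \sum_(i in A) hurwitzF (A :\ i) (x + (t i).+1).
Proof.
case hA: #|A| => [|[|q]].
- by rewrite /hurwitzF (cards0_eq hA) eqxx big_set0.
(* Singletons are separate, since [A :\ i] then falls in the empty case of [hurwitzF]. *)
- have /cards1P[i ->] : #|A| == 1 by rewrite hA.
  have n0 : [set i] != set0 by apply/set0Pn; exists i; rewrite inE.
  by rewrite big_set1 /hurwitzF (negbTE n0) cards1 !ffactn0 setDv eqxx; lia.
have n0 : A != set0 by rewrite -cards_eq0 hA.
(* The falling power is common to all [i]; only the linear factors get summed, and a polynomial
   identity remains. *)
rewrite (eq_bigr (fun i => (x + (t i).+1) * (x + tsum A + q.+1) ^_ q)) => [|i iA].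
  rewrite -big_distrl /= big_split /= sum_nat_const.
  rewrite (eq_bigr (fun i => t i + 1)) => [|i _]; last by rewrite addn1.
  rewrite big_split /= sum1_card -/(tsum A) /hurwitzF (negbTE n0) hA /=.
  rewrite !addSn ffactS_diff ffactnSr.
  have -> : x + tsum A + q.+1 - q = (x + tsum A).+1 by lia.
  by nia.
have hi : #|A :\ i| = q.+1 by move: (cardsD1 i A); rewrite iA hA; lia.
rewrite /hurwitzF -cards_eq0 hi /= (tsumD1 iA).
by congr (_ * _ ^_ _); lia.
Qed.

(** Replace [A] by [A :\ i]; its complement in [Y :\ i] is still [Y :\: A]. This turns the
    difference terms into convolutions over [Y :\ i]. *)
Lemma sum_subsets_D1 Y (f : {set I} -> {set I} -> I -> nat) :
  \sum_(A : {set I} | A \subset Y) \sum_(i in A) f (A :\ i) (Y :\: A) i =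
  \sum_(i in Y) \sum_(A : {set I} | A \subset Y :\ i) f A ((Y :\ i) :\: A) i.
Proof.
rewrite (exchange_big_dep (mem Y)) /= => [|A i sAY iA]; last exact: (subsetP sAY).
apply: eq_bigr => i iY.
rewrite (reindex_onto (fun A => i |: A) (fun A => A :\ i)) /=; last first.
  by move=> A /andP[_ iA]; rewrite setD1K.
apply: eq_big => [A | A /andP[/andP[_ _] /eqP ->]].
  rewrite setU11 andbT subUset sub1set iY subsetD1 /=; congr (_ && _).
  apply/eqP/idP => [<- | niA]; first by rewrite !inE eqxx.
  by rewrite setU1K.
by rewrite setDDl.
Qed.

Lemma hurwitz_convolution Y x y :
  \sum_(A : {set I} | A \subset Y) hurwitzF A x * hurwitzG (Y :\: A) y =
  hurwitzG Y (x + y).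
Proof.
(* The outer hypothesis keeps [x] general, as it is applied at [x + (t i).+1]. *)
have [n] := ubnP #|Y|; elim: n Y x => // n IHn Y x; rewrite ltnS => hY.
elim: x => [|x IHx].
  rewrite (bigD1 set0) ?sub0set //= {1}/hurwitzF eqxx mul1n setD0 add0n.
  rewrite big1 ?addn0 // => A /andP[_ n0].
  by rewrite /hurwitzF (negbTE n0).
rewrite (eq_bigr (fun A => hurwitzF A x * hurwitzG (Y :\: A) y +
    \sum_(i in A) hurwitzF (A :\ i) (x + (t i).+1) * hurwitzG (Y :\: A) y)).
  rewrite big_split /= IHx addSn hurwitzG_step; congr (_ + _).
  rewrite (sum_subsets_D1 Y (fun A B i => hurwitzF A (x + (t i).+1) * hurwitzG B y)).
  apply: eq_bigr => i iY; rewrite IHn.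
    by rewrite addnAC.
  by move: hY; rewrite (cardsD1 i Y) iY.
by move=> A _; rewrite hurwitzF_step mulnDl big_distrl.
Qed.

Lemma hurwitzG_fact A y : hurwitzG A y * (y + tsum A)`! = (y + tsum A + #|A|)`!.
Proof. by rewrite -(ffact_fact (leq_addl (y + tsum A) #|A|)) addnK. Qed.

(** Taking the argument as [a.+1] absorbs the predecessor of [#|A|], so the empty set obeys the same
    formula. *)
Lemma hurwitzF_fact A a :
  hurwitzF A a.+1 * (a.+1 + tsum A)`! = a.+1 * (a + tsum A + #|A|)`!.
Proof.
rewrite /hurwitzF; case: eqP => [->|/eqP].
  by rewrite /tsum big_set0 cards0 !addn0 mul1n factS.
rewrite -card_gt0; case: #|A| => // n _ /=.
rewrite -mulnA -[(a.+1 + tsum A)`!](congr1 factorial (addnK n _)).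
by rewrite ffact_fact ?leq_addl //; congr (_ * _`!); lia.
Qed.

End Hurwitz.

Lemma setbinom_fact (r : nat) (hr : 2 <= r) (m : 'I_r -> nat) (B : {set 'I_r}) :
  setbinom hr m B * \prod_(x in B) (g hr m x)`! = (sumg hr m B)`!.
Proof. exact/divnK/dvdn_prod_fact. Qed.

(** A pair in [calB'] is determined by [B.1] without [x1], which may be any subset of [Y]. *)
Lemma sum_calB' (r : nat) (hr : 2 <= r) (f : {set 'I_r} -> {set 'I_r} -> nat) :
  let Y := ~: [set x1 hr; x2 hr] in
  \sum_(B in calB' hr) f B.1 B.2 =
  \sum_(A : {set 'I_r} | A \subset Y) f (x1 hr |: A) (x2 hr |: Y :\: A).
Proof.
move=> Y.
have n12 : x1 hr != x2 hr by [].
rewrite (reindex_onto (fun A => (x1 hr |: A, x2 hr |: Y :\: A))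
                      (fun B => B.1 :\ x1 hr)) /=.
  apply: eq_bigl => A.
  apply/andP/idP => [[hB /eqP hA]|sAY].
    move: hB; rewrite inE /= => /and4P[_ dB _ _].
    apply/subsetP => x xA; rewrite !inE negb_or.
    move: (xA); rewrite -hA !inE => /andP[-> _] /=.
    apply/negP => /eqP hx; move/pred0P: dB => /(_ x).
    by rewrite /= !inE hx eqxx -hx xA orbT.
  have [n1A n2A] : x1 hr \notin A /\ x2 hr \notin A.
    by split; apply/negP => /(subsetP sAY); rewrite !inE eqxx ?orbT.
  split; last by rewrite setU1K.
  rewrite inE /= !setU11 !andbT; apply/andP; split.
    apply/eqP/setP => x; rewrite !inE.
    by case: (x == x1 hr); case: (x == x2 hr); case: (x \in A).
  apply/pred0P => x /=; rewrite !inE.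
  case: eqP => [->|_] /=; first by rewrite andbF.
  by case: eqP => [->|_] /=; rewrite ?(negbTE n2A) //; case: (x \in A).
move=> [B1 B2]; rewrite inE /= => /and4P[/eqP hU dB x1B x2B].
congr (_, _); first by rewrite setD1K.
have -> : B2 = ~: B1.
  apply/setP => x; move/setP/(_ x): hU; move/pred0P/(_ x): dB; rewrite /= !inE.
  by case: (x \in B1); case: (x \in B2).
have n2B : x2 hr \notin B1.
  by apply/negP => h; move/pred0P/(_ (x2 hr)): dB; rewrite /= h x2B.
apply/setP => x; rewrite !inE.
case: eqP => [->|_] /=; first by rewrite n2B.
by case: eqP => [->|_] /=; rewrite ?x1B // ?andbT.
Qed.

Theorem mainTheorem3 (r : nat) (hr : 2 <= r) (m : 'I_r -> nat)
    (hm : forall i : 'I_r, 0 < m i) (k : nat) (hk : k = \sum_(i < r) m i) :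
  multinomial k m =
  \sum_(B in calB' hr)
     'C(k - r + 2, sumg hr m B.2 - #|B.2| + 1) * setbinom hr m B.1 * setbinom hr m B.2.
Proof.
pose X1 := x1 hr; pose X2 := x2 hr; pose Y := ~: [set X1; X2].
pose t i := (m i).-1; pose a := (m X1).-1; pose b := m X2.
have n12 : X2 != X1 by [].
have mE i : m i = t i + 1 by rewrite /t; move: (hm i); lia.
have msum (A : {set 'I_r}) : \sum_(i in A) m i = tsum t A + #|A|.
  by rewrite (eq_bigr (fun i => t i + 1)) ?big_split ?sum1_card.
have gY (A : {set 'I_r}) : A \subset Y -> \sum_(i in A) g hr m i = tsum t A + #|A|.
  move=> sAY; rewrite -msum; apply: eq_bigr => i /(subsetP sAY).
  by rewrite /g !inE; case: eqP.
have rE : r = #|Y| + 2.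
  by rewrite -[LHS]card_ord -(cardsC [set X1; X2]) cards2 eq_sym n12 addnC.
have kE : k = a.+1 + b + tsum t Y + #|Y|.
  rewrite hk (bigID (mem [set X1; X2])) /= big_setU1 ?inE 1?eq_sym //= big_set1.
  rewrite -[RHS]addnA -msum /a prednK // -/b.
  by congr (_ + _); apply: eq_bigl => i; rewrite !inE.
(* Since [b] is positive, [r <= k] and the subtraction is exact. *)
have NE : k - r + 2 = a.+1 + b + tsum t Y by move: (hm X2) kE rE; rewrite -/b; lia.
have prod_gt0 : 0 < \prod_(i < r) (m i)`! by apply: prodn_gt0 => i; apply: fact_gt0.
apply/eqP; rewrite -(eqn_pmul2r prod_gt0); apply/eqP.
have -> : multinomial k m * \prod_(i < r) (m i)`! = k`!.
  by rewrite hk; apply/divnK/dvdn_prod_fact.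
(* The factor [a.+1] will match the one in [hurwitzF_fact]. *)
have -> : \prod_(i < r) (m i)`! = a.+1 * \prod_(i < r) (g hr m i)`!.
  rewrite (bigD1 X1) //= [in RHS](bigD1 X1) //= mulnA; congr (_ * _).
    by rewrite /g eqxx subn1 -/a -factS /a prednK.
  by apply: eq_bigr => i ni; rewrite /g (negbTE ni).
rewrite (sum_calB' hr (fun B1 B2 => 'C(k - r + 2, sumg hr m B2 - #|B2| + 1) *
  setbinom hr m B1 * setbinom hr m B2)) -/X1 -/X2 -/Y big_distrl /=.
(* The convolution at [a.+1] and [b] expands the left side over the same sets [A]; the sums then
   agree term by term. *)
have -> : k`! = \sum_(A : {set 'I_r} | A \subset Y)
    hurwitzF t A a.+1 * hurwitzG t (Y :\: A) b * (a.+1 + b + tsum t Y)`!.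
  by rewrite -big_distrl /= hurwitz_convolution hurwitzG_fact kE.
apply: eq_bigr => A sAY.
have sBY : Y :\: A \subset Y by apply: subsetDl.
have n1 (B : {set 'I_r}) : B \subset Y -> X1 \notin B.
  by move=> sB; apply/negP => /(subsetP sB); rewrite !inE eqxx.
have n2 (B : {set 'I_r}) : B \subset Y -> X2 \notin B.
  by move=> sB; apply/negP => /(subsetP sB); rewrite !inE eqxx orbT.
set B1 := X1 |: A; set B2 := X2 |: Y :\: A.
have S1 : sumg hr m B1 = a + tsum t A + #|A|.
  by rewrite /sumg big_setU1 ?n1 //= gY // /g eqxx subn1 addnA.
have S2 : sumg hr m B2 = b + tsum t (Y :\: A) + #|Y :\: A|.
  by rewrite /sumg big_setU1 ?n2 //= gY // /g (negbTE n12) addnA.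
have tY : tsum t Y = tsum t A + tsum t (Y :\: A).
  by rewrite /tsum (big_setID A) /= (setIidPr sAY).
have lowE : sumg hr m B2 - #|B2| + 1 = b + tsum t (Y :\: A).
  by rewrite S2 cardsU1 n2 //=; move: (hm X2); rewrite /b; lia.
have -> : \prod_(i < r) (g hr m i)`! =
    \prod_(i in B1) (g hr m i)`! * \prod_(i in B2) (g hr m i)`!.
  rewrite (bigID (mem B1)) /=; congr (_ * _); apply: eq_bigl => i.
  rewrite !inE.
  case: (eqVneq i X1) => [->|_] /=; first by rewrite andbF.
  by case: (eqVneq i X2) => [->|_] /=; rewrite ?(n2 A) // andbT.
rewrite lowE NE.
set N := _ + tsum t Y; set l := b + _.
have lN : l <= N by rewrite /l /N tY; lia.
have Nl : N - l = a.+1 + tsum t A by rewrite /l /N tY; lia.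
(* Of the two factorials split off from [N], [l] goes with [hurwitzG] and [N - l] with
   [hurwitzF]. *)
rewrite -(bin_fact lN) Nl.
have hF := hurwitzF_fact t A a; have hG := hurwitzG_fact t (Y :\: A) b.
rewrite -S1 -(setbinom_fact hr m B1) in hF; rewrite -S2 -(setbinom_fact hr m B2) -/l in hG.
move: hF hG.
move: (setbinom _ _ _) (setbinom _ _ _) (\prod_(_ in _) _) (\prod_(_ in _) _) => s1 s2 p1 p2.
move=> hF hG.
transitivity ('C(N, l) * (hurwitzF t A a.+1 * (a.+1 + tsum t A)`!) *
  (hurwitzG t (Y :\: A) b * l`!)); first by nia.
by rewrite hF hG; nia.
Qed.
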